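(* Let $\mathcal{G}$ be an additive subgroup of $\mathbb{R}$, let $n$ be a positive integer, and let $c,m\in\mathcal{G}$ with $c>0$ and $m\geq 0$. For all $k,k'\in\{0,1,\ldots,n-1\}$, there is a bijection from $\mathrm{SKP}_k$ to $\mathrm{SKP}_{k'}$, where $\mathrm{SKP}_k=\mathrm{SKP}_k(\mathcal{G},n;c,m)$ denotes the set of $k$-skeletal paths of height $n$ with values in $\mathcal{G}$ for parameters $c$ and $m$.
   Context: A path of height $n$ with values in $\mathcal{G}$ is a set $\pi=\{(x_i,i): i=0,1,\ldots,n-1\}\subset\mathbb{R}^2$ with $x_0\leq x_1\leq\cdots\leq x_{n-1}$ and all $x_i\in\mathcal{G}$ (one thinks of unit north steps from $(x_i,i)$ to $(x_i,i+1)$ joined by east steps). For $k\in\{0,1,\ldots,n-1\}$, such a path is $k$-skeletal (for parameters $c,m$) iff: (P0) $x_0\geq 0$; (P1) $x_i<mi+c$ for all $i\in\{n-k-1,\ldots,n-1\}$; (P2) for every $i\in\{0,1,\ldots,n-k-1\}$ there exists $j\in\{i,i+1,\ldots,i+k\}$ with $x_j\geq mj$. *)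

(* Defs.v *)
From HB Require Import structures.
From mathcomp Require Import all_boot all_order all_algebra.
From mathcomp Require Import all_classical all_reals.

Set Implicit Arguments.
Unset Strict Implicit.
Unset Printing Implicit Defensive.

Import Order.TTheory GRing.Theory Num.Theory.
Local Open Scope classical_set_scope.
Local Open Scope ring_scope.

(* The path as a subset of the plane. The second coordinates recover the
   indices, so the set determines the sequence [x]. *)
Definition path_points (R : realType) (n : nat) (x : 'I_n -> R) : set (R * R) :=
  [set (x i, (i : nat)%:R) | i in [set: 'I_n]].

Definition path_coords (R : realType) (G : zmodClosed R) (n : nat)
    (x : 'I_n -> R) : Prop :=
  (forall i : 'I_n, x i \in G) /\
  (forall i j : 'I_n, (i <= j)%N -> x i <= x j).

Definition skeletal (R : realType) (n : nat) (c m : R) (k : nat)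
    (x : 'I_n -> R) : Prop :=
  [/\ forall i : 'I_n, (i : nat) = 0%N -> 0 <= x i,
      forall i : 'I_n, (n - k - 1 <= i)%N -> x i < m * (i : nat)%:R + c
    & forall i : 'I_n, (i <= n - k - 1)%N ->
        exists2 j : 'I_n, (i <= j <= i + k)%N & m * (j : nat)%:R <= x j].

Definition SKP (R : realType) (G : zmodClosed R) (n : nat) (c m : R)
    (k : nat) : set (set (R * R)) :=
  [set path_points x | x in [set x : 'I_n -> R |
     path_coords G x /\ skeletal c m k x]].

(* Main.v *)
(** Put [y_i = x_i - m i] and extend [y] to all integers by [y_(i+n) = y_i + c].
    Paths then become the walks on the integers with steps at least [-m] and
    this quasi-periodicity. Such a walk is negative near minus infinity and
    nonnegative near plus infinity, and the path is [k]-skeletal exactly when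
    the last block of [k+1] consecutive negative values ends at index [-1].
    Hence every orbit of walks under integer translation contains exactly one
    [k]-skeletal walk, whatever [k] is, and the bijection matches the
    representatives of each orbit. *)
Require Import Defs.
From HB Require Import structures.
From mathcomp Require Import all_boot all_order all_algebra.
From mathcomp Require Import all_classical all_reals.
From mathcomp Require Import zify ring lra.

Set Implicit Arguments.
Unset Strict Implicit.
Unset Printing Implicit Defensive.

Import Order.TTheory GRing.Theory Num.Theory.
Local Open Scope classical_set_scope.
Local Open Scope ring_scope.

(** Choice turns a relation that is total and single-valued in both directions into a map, so no
    explicit formula for the bijection is required. The inhabitant of [U] supplies the values
    outside [A]. *)
Lemma set_bij_of_rel (T U : Type) (A : set T) (B : set U) (Q : T -> U -> Prop) :
  (forall a, A a -> exists2 b, B b & Q a b) ->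
  (forall b, B b -> exists2 a, A a & Q a b) ->
  (forall a b b', A a -> B b -> B b' -> Q a b -> Q a b' -> b = b') ->
  (forall a a' b, A a -> A a' -> B b -> Q a b -> Q a' b -> a = a') ->
  inhabited U ->
  exists f : T -> U, set_bij A B f.
Proof.
move=> totA totB funA funB [u0].
have /choice[f fP] : forall a, exists b, A a -> B b /\ Q a b.
  move=> a; have [Aa|nAa] := pselect (A a); last by exists u0.
  by have [b Bb Qab] := totA a Aa; exists b.
exists f; split.
- by move=> a /fP[].
- move=> a a' /set_mem Aa /set_mem Aa' faa'.
  have [Bfa Qa] := fP a Aa; have [_ Qa'] := fP a' Aa'.
  by apply: (funB a a' (f a)) => //; rewrite faa'.
- move=> b Bb; have [a Aa Qab] := totB b Bb; exists a => //.
  by have [Bfa Qa] := fP a Aa; apply: (funA a).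
Qed.

(** * Quasi-periodic walks and their translates *)

Section Walks.
Variables (R : realType) (G : zmodClosed R) (n : nat) (c m : R).

(** The paths have height [n.+1]. The step bound makes [z i + m * i] weakly increasing in [i]. *)
Definition walk (z : int -> R) : Prop :=
  [/\ forall i, z i \in G, forall i, z i - m <= z (i + 1)
    & forall i, z (i + n.+1%:Z) = z i + c].

Definition shift (t : int) (z : int -> R) : int -> R := fun i => z (i + t).

Lemma shift_shift s t z : shift s (shift t z) = shift (s + t) z.
Proof. by apply/funext => i; rewrite /shift addrA. Qed.

Lemma shift0 z : shift 0 z = z.
Proof. by apply/funext => i; rewrite /shift addr0. Qed.

Lemma walk_shift t z : walk z -> walk (shift t z).
Proof.
by case=> zG zs zp; split=> i; rewrite /shift // addrAC.
Qed.

Lemma walk_period z : walk z ->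
  forall (q i : int), z (i + q * n.+1%:Z) = z i + c *~ q.
Proof.
case=> _ _ zp.
have zpn (q : nat) i : z (i + q%:Z * n.+1%:Z) = z i + c *~ q.
  elim: q => [|q IH]; first by rewrite mul0r !addr0.
  have -> : i + q.+1%:Z * n.+1%:Z = i + q%:Z * n.+1%:Z + n.+1%:Z.
    by rewrite intS; ring.
  by rewrite zp IH intS mulrzDr mulr1z -addrA [c + _]addrC.
move=> q i; case: q => q //.
(* For a negative number of periods, the nonnegative case is applied at the translated index and
   cancelled. *)
rewrite NegzE; have := zpn q.+1 (i + - q.+1%:Z * n.+1%:Z).
by rewrite -addrA -mulrDl addNr mul0r addr0 => ->; rewrite -addrA -mulrzDr
  subrr addr0.
Qed.

(** * Runs of negative values *)

(* The [L] indices before [t], excluding [t] itself. *)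
Definition neg_run (L : nat) (z : int -> R) (t : int) : Prop :=
  forall j : int, t - L%:Z <= j < t -> z j < 0.

Definition last_neg_run (L : nat) (z : int -> R) (t : int) : Prop :=
  neg_run L z t /\ forall s, t < s -> ~ neg_run L z s.

Lemma last_neg_run_unique L z s t :
  last_neg_run L z s -> last_neg_run L z t -> s = t.
Proof.
move=> [rs ls] [rt lt_].
by have [/ls|/lt_|//] := ltgtP s t.
Qed.

Lemma neg_run_shift L z s t : neg_run L (shift s z) t <-> neg_run L z (t + s).
Proof.
split=> h j jP.
  by have := h (j - s); rewrite /shift subrK; apply; lia.
by apply: h; lia.
Qed.

Lemma last_neg_run_shift L z s t :
  last_neg_run L (shift s z) t <-> last_neg_run L z (t + s).
Proof.
split=> -[r l]; split; try exact/neg_run_shift.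
  move=> u tu ru; apply: (l (u - s)); first by lia.
  by apply/neg_run_shift; rewrite subrK.
by move=> u tu /neg_run_shift; apply: l; lia.
Qed.

(** On one period [z] is bounded by [B], and [a] periods further it has moved by [a] times [c]. Once
    [c] times [q] exceeds [B], the drift decides the sign. *)
Lemma walk_signs (hc : 0 < c) z : walk z ->
  exists N : nat, forall j : int, (j < - N%:Z -> z j < 0) /\ (N%:Z <= j -> 0 <= z j).
Proof.
move=> zW.
pose B := \sum_(i < n.+1) `|z i%:Z|.
have zB (i : nat) : (i < n.+1)%N -> `|z i%:Z| <= B.
  move=> ilt; rewrite /B (bigD1 (Ordinal ilt)) //= lerDl.
  by apply: sumr_ge0.
have [q qP] : exists q : nat, B < c *~ q%:Z.
  exists (Num.bound (B / c)).
  have := @archi_boundP _ (B / c); rewrite ltr_pdivrMr // => h.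
  rewrite -pmulrn -mulr_natl; apply: h.
  by apply: divr_ge0; [exact: sumr_ge0|exact: ltW].
exists ((q + 1) * n.+1)%N => j.
set a := (j %/ n.+1%:Z)%Z; set r := (j %% n.+1%:Z)%Z.
have jE : j = a * n.+1%:Z + r by exact: divz_eq.
have rge : 0 <= r by exact: modz_ge0.
have rlt : r < n.+1%:Z by exact: ltz_pmod.
have zj : z j = z r + c *~ a by rewrite {1}jE addrC walk_period.
have zr : `|z r| <= B.
  by move: rge rlt; case: (r) => // r' _ rlt; apply: zB; lia.
move: zr; rewrite ler_norml => /andP[zr1 zr2].
split=> jN.
  have aq : a <= - q%:Z by nia.
  have : c *~ a <= c *~ (- q%:Z) by rewrite ler_pMz2l.
  by rewrite zj mulrNz; lra.
have aq : q%:Z <= a by nia.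
have : c *~ q%:Z <= c *~ a by rewrite ler_pMz2l.
by rewrite zj; lra.
Qed.

Lemma last_neg_run_exists (hc : 0 < c) L z : walk z ->
  exists t, last_neg_run L.+1 z t.
Proof.
move=> /(walk_signs hc)[N NP].
(* Run ends are counted from [- N] so that [ex_maxnP] applies: a run does end at [- N], and one
   ending past [N] would contain an index where [z] is nonnegative. *)
pose P (s : nat) := `[< neg_run L.+1 z (s%:Z - N%:Z) >].
have P0 : exists s, P s.
  by exists 0%N; apply/asboolP => j jP; apply: (NP j).1; lia.
have PB s : P s -> (s <= N + N)%N.
  move=> /asboolP rs; rewrite leqNgt; apply/negP => sN.
  have := rs (s%:Z - N%:Z - 1) ltac:(lia).
  by rewrite ltNge => /negP; apply; apply: (NP _).2; lia.
case: (ex_maxnP P0 PB) => s /asboolP rs smax.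
exists (s%:Z - N%:Z); split=> // u su ru.
have uE : (`|(u + N%:Z)%R|%N : int) - N%:Z = u by lia.
have /smax : P `|(u + N%:Z)%R|%N by rewrite /P uE; exact/asboolP.
by lia.
Qed.

(** * Passing between walks and paths *)

Definition path_of_walk (z : int -> R) : 'I_n.+1 -> R :=
  fun i => z (i : nat)%:Z + m * (i : nat)%:R.

(** The remainder is always below [n.+1], so [inord] never falls back on its default value. *)
Definition walk_of_path (x : 'I_n.+1 -> R) : int -> R := fun i =>
  let r := `|(i %% n.+1%:Z)%Z|%N in
  x (inord r) - m * r%:R + c *~ (i %/ n.+1%:Z)%Z.

Lemma walk_of_pathK x : path_of_walk (walk_of_path x) = x.
Proof.
apply/funext => i; rewrite /path_of_walk /walk_of_path.
have -> : ((i : nat)%:Z %% n.+1%:Z)%Z = (i : nat)%:Z.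
  by rewrite modz_small //; have := ltn_ord i; lia.
have -> : ((i : nat)%:Z %/ n.+1%:Z)%Z = 0.
  by rewrite divz_small //; have := ltn_ord i; lia.
by rewrite inord_val mulr0z addr0 subrK.
Qed.

Lemma walk_ext z z' : walk z -> walk z' ->
  path_of_walk z = path_of_walk z' -> z = z'.
Proof.
move=> zW zW' e; apply/funext => j.
have rge : 0 <= (j %% n.+1%:Z)%Z by exact: modz_ge0.
have rlt : (j %% n.+1%:Z)%Z < n.+1%:Z by exact: ltz_pmod.
rewrite (divz_eq j n.+1%:Z) addrC !walk_period //; congr (_ + _).
case: (j %% n.+1%:Z)%Z rge rlt => // r _ rlt.
have rlt' : (r < n.+1)%N by lia.
by have := congr1 (@^~ (Ordinal rlt')) e; rewrite /path_of_walk /=; apply: addIr.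
Qed.

Lemma path_of_walk_coords z : m \in G -> walk z -> path_coords G (path_of_walk z).
Proof.
move=> mG [zG zs _]; split=> [i|i j].
  by rewrite /path_of_walk rpredD // mulr_natr rpredMn.
move=> /subnKC; rewrite /path_of_walk => <-.
elim: (j - i)%N => [|d IH]; first by rewrite addn0.
apply: le_trans IH _; rewrite addnS.
have := zs (i + d)%N%:Z; rewrite -natr1 mulrDr mulr1.
have -> : (i + d)%N%:Z + 1 = (i + d).+1%:Z :> int by lia.
by lra.
Qed.

(** Moved back by one period, P1 says that the [k.+1] values before index 0 are negative. P0 and P2
    together say that no window of [k.+1] indices ending later is entirely negative. *)
Lemma skeletal_path_of_walk (hc : 0 < c) z k : (k < n.+1)%N -> walk z ->
  skeletal c m k (path_of_walk z) <-> last_neg_run k.+1 z 0.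
Proof.
move=> kn zW; have [_ _ zp] := zW.
have ge0P (i : 'I_n.+1) :
    m * (i : nat)%:R <= path_of_walk z i <-> 0 <= z (i : nat)%:Z.
  by rewrite /path_of_walk lerDr.
have ltcP (i : 'I_n.+1) : path_of_walk z i < m * (i : nat)%:R + c <->
    z ((i : nat)%:Z - n.+1%:Z) < 0.
  have := zp ((i : nat)%:Z - n.+1%:Z); rewrite subrK /path_of_walk => ->.
  by split; lra.
split=> [[P0 P1 P2]|[run last]].
  have z0 : 0 <= z 0.
    by have := P0 ord0 erefl; rewrite /path_of_walk mulr0 addr0.
  (* One period of window ends: a window with [s <= k] contains index 0, settled by P0; the others
     start at [s - k.+1], where P2 applies. *)
  have window (s : nat) : (0 < s <= n.+1)%N ->
      exists2 j : int, s%:Z - k.+1%:Z <= j < s%:Z & 0 <= z j.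
    move=> sP; have [ks|sk] := leqP k.+1 s; last by exists 0; rewrite ?z0 //; lia.
    have iP : (s - k.+1 < n.+1)%N by lia.
    have [] := P2 (Ordinal iP); first by rewrite /=; lia.
    by move=> j /= jP /ge0P zj; exists (j : nat)%:Z => //; lia.
  split=> [j jP|s s0 run].
    have iP : (`|(j + n.+1%:Z)%R| < n.+1)%N by lia.
    have := P1 (Ordinal iP) ltac:(rewrite /=; lia).
    by move=> /ltcP /=; congr (z _ < 0); lia.
  (* Dividing [s - 1] rather than [s] puts the reduced end between 1 and [n.+1]. Moving back up by
     whole periods only adds nonnegative multiples of [c]. *)
  have rge : 0 <= ((s - 1) %% n.+1%:Z)%Z by exact: modz_ge0.
  have rlt : ((s - 1) %% n.+1%:Z)%Z < n.+1%:Z by exact: ltz_pmod.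
  have sE := divz_eq (s - 1) n.+1%:Z.
  have q0 : 0 <= ((s - 1) %/ n.+1%:Z)%Z by rewrite divz_ge0 //; lia.
  have [|j jP zj] := window `|(((s - 1) %% n.+1%:Z)%Z + 1)%R|%N; first by lia.
  have := run (j + ((s - 1) %/ n.+1%:Z)%Z * n.+1%:Z) ltac:(lia).
  rewrite walk_period //.
  have : 0 <= c *~ ((s - 1) %/ n.+1%:Z)%Z by rewrite mulrz_ge0 // ltW.
  by lra.
have window (s : int) : 0 < s -> exists2 j, s - k.+1%:Z <= j < s & 0 <= z j.
  move=> /last nrun; apply: contrapT => h; apply: nrun => j jP.
  by rewrite ltNge; apply/negP => zj; apply: h; exists j.
(* The window ending at 1 has a nonnegative value, and all its indices but 0 lie in the negative
   run. *)
have z0 : 0 <= z 0.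
  have [//|j jP zj] := window 1.
  have [j0|j0] := ltP j 0; last by have <- : j = 0 by lia.
  by have := run j ltac:(lia); rewrite ltNge zj.
split=> [i i0|i iP|i iP].
- by rewrite /path_of_walk i0 mulr0 addr0.
- by apply/ltcP/run; have := ltn_ord i; lia.
- have [|j jP zj] := window ((i : nat)%:Z + k.+1%:Z); first by lia.
  have jlt : (`|j| < n.+1)%N by lia.
  exists (Ordinal jlt); first by rewrite /=; lia.
  by apply/ge0P; rewrite /=; have -> : absz j = j :> int by lia.
Qed.

(** Within a period the step bound is monotonicity of [x]; the skeletal conditions serve for the
    step from one period to the next. *)
Lemma walk_of_path_walk (hm : 0 <= m) x k : c \in G -> m \in G ->
  path_coords G x -> skeletal c m k x -> walk (walk_of_path x).
Proof.
move=> cG mG [xG xle] [P0 P1 _].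
have per i : walk_of_path x (i + n.+1%:Z) = walk_of_path x i + c.
  by rewrite /walk_of_path modzDr divzDr ?dvdzz // divzz mulrzDr mulr1z addrA.
split=> // i; first by rewrite rpredD ?rpredB ?rpredMz // mulr_natr rpredMn.
have rge : 0 <= (i %% n.+1%:Z)%Z by exact: modz_ge0.
have rlt : (i %% n.+1%:Z)%Z < n.+1%:Z by exact: ltz_pmod.
have iE : i + 1 = (i %/ n.+1%:Z)%Z * n.+1%:Z + ((i %% n.+1%:Z)%Z + 1).
  by rewrite addrA -divz_eq.
have [rn|rn] := ltP ((i %% n.+1%:Z)%Z + 1) n.+1%:Z.
  have rE : ((i + 1) %% n.+1%:Z)%Z = (i %% n.+1%:Z)%Z + 1.
    by rewrite iE modzMDl modz_small //; lia.
  have qE : ((i + 1) %/ n.+1%:Z)%Z = (i %/ n.+1%:Z)%Z.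
    by rewrite iE divzMDl // [X in _ + X]divz_small ?addr0 //; lia.
  rewrite /walk_of_path rE qE.
  have -> : `|((i %% n.+1%:Z)%Z + 1)%R|%N = `|(i %% n.+1%:Z)%Z|%N.+1 by lia.
  set r := `|(i %% n.+1%:Z)%Z|%N.
  have : x (inord r) <= x (inord r.+1) by apply: xle; rewrite !inordK; lia.
  by rewrite -natr1; lra.
have rN : (i %% n.+1%:Z)%Z + 1 = n.+1%:Z by lia.
have rE : ((i + 1) %% n.+1%:Z)%Z = 0 by rewrite iE rN modzMDl modzz.
have qE : ((i + 1) %/ n.+1%:Z)%Z = (i %/ n.+1%:Z)%Z + 1.
  by rewrite iE rN divzMDl // divzz.
rewrite /walk_of_path rE qE.
have -> : `|(i %% n.+1%:Z)%Z|%N = n by lia.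
(* P1 at the last index, P0 and [0 <= m] give [x n - m * n - m < c <= x 0 + c]. *)
have := P1 (inord n) ltac:(rewrite inordK //; lia).
have := P0 (inord 0) (inordK (ltn0Sn n)).
by rewrite absz0 inordK // mulrzDr mulr1z mulr0; lra.
Qed.

End Walks.

(** * Matching skeletal paths along orbits *)

Lemma path_points_inj (R : realType) (n : nat) : injective (@path_points R n).
Proof.
move=> x y xy; apply/funext => i.
have : path_points y (x i, (i : nat)%:R) by rewrite -xy; exists i.
case=> j _ [<- /eqP]; rewrite eqr_nat => /eqP ji.
by congr y; apply: val_inj.
Qed.

(** In this form [k] enters only through the run length, so different values of [k] can be compared
    on the same walks. *)
Lemma SKP_walkP (R : realType) (G : zmodClosed R) (n : nat) (c m : R) (k : nat) p :
  c \in G -> m \in G -> 0 < c -> 0 <= m -> (k < n.+1)%N ->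
  SKP G n.+1 c m k p <-> exists z, [/\ walk G n c m z, last_neg_run k.+1 z 0 &
    p = path_points (path_of_walk (n := n) m z)].
Proof.
move=> cG mG c0 m0 kn; split=> [[x [xG xk] <-]|[z [zW zk ->]]].
  have zW := walk_of_path_walk m0 cG mG xG xk.
  exists (walk_of_path c m x); split=> //; last by rewrite walk_of_pathK.
  by apply/(skeletal_path_of_walk c0 kn zW); rewrite walk_of_pathK.
exists (path_of_walk m z) => //; split; first exact: path_of_walk_coords zW.
exact/(skeletal_path_of_walk c0 kn zW).
Qed.

Theorem theorem2p1 (R : realType) (G : zmodClosed R) (n : nat) (c m : R)
    (hn : (0 < n)%N) (hcG : c \in G) (hmG : m \in G)
    (hc : 0 < c) (hm : 0 <= m) (k k' : 'I_n) :
  exists f : set (R * R) -> set (R * R),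
    set_bij (SKP G n c m k) (SKP G n c m k') f.
Proof.
case: n hn k k' => // n _ k k'.
pose pts (z : int -> R) := path_points (path_of_walk (n := n) m z).
(* Two paths are related when their walks lie in one translation orbit. *)
pose Q p p' := exists2 z, walk G n c m z & exists t,
  p = pts z /\ p' = pts (shift t z).
have QC p p' : Q p p' -> Q p' p.
  move=> [z zW [t [-> ->]]]; exists (shift t z); first exact: walk_shift.
  by exists (- t); rewrite shift_shift addNr shift0.
have total (l l' : 'I_n.+1) p : SKP G n.+1 c m l p ->
    exists2 p', SKP G n.+1 c m l' p' & Q p p'.
  move=> /(SKP_walkP _ hcG hmG hc hm (ltn_ord l))[z [zW _ ->]].
  (* Translating by the end of the last run of length [l'.+1] brings that end to 0. *)
  have [t zt] := last_neg_run_exists hc l' zW.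
  exists (pts (shift t z)); last by exists z => //; exists t.
  apply/(SKP_walkP _ hcG hmG hc hm (ltn_ord l')); exists (shift t z).
  by split=> //; [exact: walk_shift|apply/last_neg_run_shift; rewrite add0r].
have pts_inj z z' : walk G n c m z -> walk G n c m z' -> pts z = pts z' -> z = z'.
  by move=> zW zW' /path_points_inj; apply: walk_ext zW zW'.
have func (l : 'I_n.+1) p q q' : SKP G n.+1 c m l q -> SKP G n.+1 c m l q' ->
    Q p q -> Q p q' -> q = q'.
  move=> /(SKP_walkP _ hcG hmG hc hm (ltn_ord l))[w [wW wl ->]].
  move=> /(SKP_walkP _ hcG hmG hc hm (ltn_ord l))[w' [wW' wl' ->]].
  (* Both targets are translates of one walk, by [t] and [t']; its last run ends at both places, so
     [t = t']. *)
  move=> [z zW [t [-> wE]]] [z' zW' [t' [zE wE']]].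
  have zz' := pts_inj _ _ zW zW' zE; move: wE'; rewrite -zz' => wE'.
  move: wl wl'; rewrite wE wE' (pts_inj _ _ wW (walk_shift t zW) wE).
  rewrite (pts_inj _ _ wW' (walk_shift t' zW) wE').
  move=> /last_neg_run_shift lt_ /last_neg_run_shift lt'.
  by have := last_neg_run_unique lt_ lt'; rewrite !add0r => ->.
apply: (@set_bij_of_rel _ _ _ _ Q).
- by move=> p; apply: total.
- by move=> p /(total _ k)[p' p'P /QC]; exists p'.
- by move=> p q q' _; apply: func.
- by move=> p p' q pP p'P _ /QC qp /QC; apply: func pP p'P qp.
- exact: inhabits set0.
Qed.
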